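(* Consider the interval game with a single enemy $\varphi$ and with $\psi$, where $\varphi,\psi$ are orientation-preserving homeomorphisms of $S^1$, and suppose the rotation number of $\psi$ is irrational. Let $\mu$ be an invariant probability measure for $\psi$. If $\varphi$ does not preserve $\mu$, then there is a winning interval.
   Context: $S^1=\mathbb{R}/\mathbb{Z}$. Interval game: the data are finitely many orientation-preserving homeomorphisms $\varphi_1,\dots,\varphi_m$ of $S^1$ (the enemies; here $m=1$ and $\varphi_1=\varphi$) and an orientation-preserving homeomorphism $\psi$ of $S^1$. A closed (nondegenerate, proper) interval $I\subset S^1$ wins (is a winning interval) if there is a positive integer $n$ such that $\psi^i(I^+)\notin\varphi_j(I)$ for all $j$ and all $0\le i\le n$, and such that $\psi^n(I^+)$ is contained in the interior of $I$, where $I^+$ denotes the rightmost point of $I$ (with respect to the orientation of $S^1$). *)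

(* Defs.v *)
From HB Require Import structures.
From mathcomp Require Import all_boot all_order all_algebra.
From mathcomp Require Import all_classical all_reals all_analysis.

Set Implicit Arguments.
Unset Strict Implicit.
Unset Printing Implicit Defensive.

Import Order.TTheory GRing.Theory Num.Theory.
Import numFieldNormedType.Exports.

Local Open Scope classical_set_scope.
Local Open Scope ring_scope.
Local Open Scope quotient_scope.

Section circle_quotient.
Variable R : realType.

Definition eq_mod1 (x y : R) : bool := (x - y) \is a Num.int.

Lemma eq_mod1_refl : reflexive eq_mod1.
Proof. by move=> x; rewrite /eq_mod1 subrr rpred0. Qed.

Lemma eq_mod1_sym : symmetric eq_mod1.
Proof. by move=> x y; rewrite /eq_mod1 -opprB rpredN. Qed.

Lemma eq_mod1_trans : transitive eq_mod1.
Proof.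
by move=> y x z xy yz; rewrite /eq_mod1 -[x](subrK y) -addrA; exact: rpredD.
Qed.

Canonical eq_mod1_equiv := EquivRel eq_mod1 eq_mod1_refl eq_mod1_sym eq_mod1_trans.

Definition circle := quotient_topology {eq_quot eq_mod1}.
HB.instance Definition _ := Topological.on circle.
HB.instance Definition _ := Pointed.on circle.
HB.instance Definition _ := Quotient.on circle.

Definition circle_proj (x : R) : circle := \pi_circle x.

Lemma circle_projE (x y : R) :
  circle_proj x = circle_proj y <-> (x - y) \is a Num.int.
Proof.
by split=> [/eqmodP //|xy]; apply/eqmodP.
Qed.

Definition borel_circle := g_sigma_algebraType (@open circle).
HB.instance Definition _ := Measurable.on borel_circle.

End circle_quotient.

Section circle_homeomorphisms.
Variable R : realType.
Implicit Types (f : circle R -> circle R) (F : R -> R).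

Definition is_homeomorphism f :=
  exists g : circle R -> circle R,
    [/\ continuous f, continuous g, cancel f g & cancel g f].

Definition is_lift f F :=
  continuous F /\ forall x, circle_proj (F x) = f (circle_proj x).

Definition orientation_preserving_homeo f :=
  is_homeomorphism f /\
  exists2 F : R -> R, is_lift f F & {homo F : x y / x < y}.

(* For an orientation-preserving homeomorphism f the limit exists, does not
   depend on x, and changes by an integer when another lift is chosen, so that
   f has exactly one rotation number in R/Z. *)
Definition is_rotation_number f (rho : circle R) :=
  exists F : R -> R, exists r : R,
    [/\ is_lift f F,
        forall x, (iter n F x - x) / n%:R @[n --> \oo] --> r
      & rho = circle_proj r].

Definition irrational_mod1 (rho : circle R) :=
  ~ (@circle_proj R @` @rational R) rho.

Definition preserves_measure (mu : set (borel_circle R) -> \bar R) f :=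
  forall A : set (borel_circle R), measurable A -> mu (f @^-1` A) = mu A.

End circle_homeomorphisms.

Section interval_game.
Variable R : realType.

(* For a < b < a + 1 this is the closed interval of the circle running from
   circle_proj a to its rightmost point circle_proj b; it is nondegenerate and
   proper, and every such interval has this form. *)
Definition circle_arc (a b : R) : set (circle R) := @circle_proj R @` `[a, b].

Definition winning_interval (m : nat) (phi : 'I_m -> circle R -> circle R)
    (psi : circle R -> circle R) (I : set (circle R)) :=
  exists a b : R,
    [/\ a < b, b < a + 1, I = circle_arc a b &
      exists2 n : nat, (0 < n)%N &
        (forall (j : 'I_m) (i : nat), (i <= n)%N ->
           ~ (phi j @` I) (iter i psi (circle_proj b))) /\
        interior I (iter n psi (circle_proj b))].

End interval_game.

(* Main.v *)
Require Import Defs.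
From mathcomp Require Import all_boot all_order all_algebra.
From mathcomp Require Import all_classical all_reals all_analysis.
From mathcomp Require Import zify ring lra.

Set Implicit Arguments.
Unset Strict Implicit.
Unset Printing Implicit Defensive.

Import Order.TTheory GRing.Theory Num.Theory.
Import numFieldNormedType.Exports.

Local Open Scope classical_set_scope.
Local Open Scope ring_scope.

(** Let H : R -> R be a lift of the distribution function of mu, F a lift of psi
    and Phi a lift of phi.  Invariance of mu gives H (F x) = H x + alpha, where
    alpha is the rotation number; alpha being irrational, the monotone function
    H has dense range and is therefore continuous.  As phi does not preserve mu,
    D = H \o Phi - H is not constant.  Let q be a return time of the rotation by
    alpha, from the left, at distance d, closer than all earlier returns.  An
    interval [a, b] with H b - H a slightly above d wins with n = q as soon as no
    i alpha + k with i <= q lies in [H (Phi a), H (Phi b)] - H b.  The length of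
    this interval exceeds H b - H a exactly by D b - D a, so it fits into a gap
    of these points when D descends across one of them between a and b. *)

(** * Integer multiples of an irrational number modulo 1 *)

Section diophantine.
Variable R : realType.
Implicit Types (x e d : R) (k n q : nat) (z : int).

Definition dist_int x : R :=
  Num.min (x - (Num.floor x)%:~R) ((Num.floor x)%:~R + 1 - x).

Lemma dist_int_le x z : dist_int x <= `|x - z%:~R|.
Proof.
rewrite /dist_int; have := floor_itv x; rewrite intrD => /andP[f1 f2].
rewrite ge_min; have [zf|fz] := leP z (Num.floor x).
  apply/orP; left; apply: le_trans (ler_norm _).
  by rewrite lerB// ler_int.
apply/orP; right; rewrite distrC; apply: le_trans (ler_norm _).
by rewrite lerB// -[1]/(1%:~R) -intrD ler_int lezD1.
Qed.

Lemma dist_int_attained x :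
  exists z : int, x = z%:~R + dist_int x \/ x = z%:~R - dist_int x.
Proof.
rewrite /dist_int /Num.min; case: ifP => _.
  by exists (Num.floor x); left; rewrite addrC subrK.
by exists (Num.floor x + 1); right; rewrite intrD opprB addrC subrK.
Qed.

Lemma dist_int_half x : dist_int x <= 1 / 2.
Proof.
rewrite /dist_int ge_min; have [//|h] := leP (x - (Num.floor x)%:~R) (1 / 2).
by apply/orP; right; lra.
Qed.

(** Finitely many strict inequalities leave room above [c]. This supplies thresholds below all early
    return distances. *)
Lemma finite_gap (f : nat -> R) n (c d : R) :
  c < d -> (forall k, (k < n)%N -> c < f k) ->
  exists s, [/\ c < s, s < d & forall k, (k < n)%N -> s < f k].
Proof.
move=> cd; elim: n => [|n IH] fc.
  by exists ((c + d) / 2); split => //; lra.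
have [|s [cs sd sf]] := IH; first by move=> k kn; apply: fc; exact: leqW.
have cm : c < Num.min s (f n) by rewrite lt_min cs fc.
have [m1 m2] : Num.min s (f n) <= s /\ Num.min s (f n) <= f n.
  by rewrite !ge_min !lexx orbT.
exists ((c + Num.min s (f n)) / 2); split; [lra|lra|].
move=> k; rewrite ltnS leq_eqVlt => /predU1P[->|/sf]; lra.
Qed.

Variable alpha : R.
Hypothesis alpha_irr : forall k z, (0 < k)%N -> k%:R * alpha <> z%:~R.

Lemma dist_int_gt0 k : (0 < k)%N -> 0 < dist_int (k%:R * alpha).
Proof.
move=> k0; rewrite /dist_int.
have := floor_itv (k%:R * alpha); rewrite intrD => /andP[f1 f2].
rewrite lt_min !subr_gt0 f2 andbT lt_neqAle f1 andbT.
by apply/eqP => /esym; exact: alpha_irr.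
Qed.

(* If k alpha is at distance d from an integer and m is the integer nearest to
   1 / d, then m k alpha is at distance at most d / 2 from an integer. *)
Lemma dist_int_halve k : (0 < k)%N -> exists2 k', (0 < k')%N &
  dist_int (k'%:R * alpha) <= dist_int (k%:R * alpha) / 2.
Proof.
move=> k0; set d := dist_int _; have d0 : 0 < d by exact: dist_int_gt0.
have d2 : d <= 1 / 2 by exact: dist_int_half.
have /andP[] := floor_itv (d^-1 + 1 / 2); rewrite intrD.
have : (0 <= Num.floor (d^-1 + 1 / 2))%R.
  by rewrite floor_ge0 addr_ge0// ?invr_ge0 ltW.
case: (Num.floor _) => // m _ m1 m2; rewrite -!pmulrn in m1 m2.
have dd : d * d^-1 = 1 by rewrite divff// gt_eqF.
have m3 : m%:R * d <= 1 + d / 2 by nra.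
have m4 : 1 - d / 2 <= m%:R * d by nra.
have m0 : (0 < m)%N by case: m {m1 m2 m3} m4 => //; rewrite mul0r; lra.
exists (m * k)%N; first by rewrite muln_gt0 m0.
have [z [|]] := dist_int_attained (k%:R * alpha); rewrite -/d => E.
- apply: le_trans (dist_int_le _ (m%:Z * z + 1)) _.
  rewrite natrM -mulrA E intrD intrM -pmulrn ler_norml; apply/andP; split; nra.
- apply: le_trans (dist_int_le _ (m%:Z * z - 1)) _.
  rewrite natrM -mulrA E intrB intrM -pmulrn ler_norml; apply/andP; split; nra.
Qed.

Lemma dist_int_small e : 0 < e ->
  exists2 k, (0 < k)%N & dist_int (k%:R * alpha) < e.
Proof.
move=> e0.
have H n : exists2 k, (0 < k)%N & dist_int (k%:R * alpha) <= 1 / 2 ^+ n.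
  elim: n => [|n [k k0 kn]].
    by exists 1%N => //; have := dist_int_half (1 * alpha); rewrite expr0; lra.
  have [k' k'0 le] := dist_int_halve k0; exists k' => //.
  by apply: le_trans le _; move: kn; rewrite exprS !div1r invfM; lra.
(* [upper_nthrootP] gives [e^-1 < 2 ^+ n] for [n = Num.bound e^-1]. *)
have [k k0 le] := H (Num.bound e^-1); exists k => //.
apply: le_lt_trans le _; rewrite div1r -[ltRHS]invrK ltf_pV2 ?posrE ?invr_gt0//.
exact: upper_nthrootP.
Qed.

Lemma first_small (m : R) : 0 < m -> exists q, [/\ (0 < q)%N,
   dist_int (q%:R * alpha) < m &
   forall k, (0 < k < q)%N -> m <= dist_int (k%:R * alpha)].
Proof.
move=> m0.
pose P k := (0 < k)%N && (dist_int (k%:R * alpha) < m).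
have exP : exists k, P k by have [k k0 km] := dist_int_small m0; exists k; exact/andP.
case: (ex_minnP exP) => q /andP[q0 qm] qmin; exists q; split => // k /andP[k0 kq].
by rewrite leNgt; apply/negP => km; have := qmin k; rewrite /P k0 km leqNgt kq => /(_ isT).
Qed.

(* Good approximations come from both sides: if the record at q is attained from
   the right, at distance d, then the next record is attained from the left,
   since a later point in ]0, d[ would, shifted back by q, give an earlier
   point in ]-d, 0[. *)
Lemma left_record N e : 0 < e -> exists q z (d : R), [/\ (N < q)%N,
  q%:R * alpha = z%:~R - d, 0 < d < e &
  forall k, (0 < k < q)%N -> d < dist_int (k%:R * alpha)].
Proof.
move=> e0.
(* A threshold [m] below the distances of the first [N] multiples forces the record index beyond
   [N]. *)
have [|m [m0 me mN]] := @finite_gap (fun k => dist_int (k.+1%:R * alpha)) N 0 e e0.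
  by move=> k _; exact: dist_int_gt0.
have [q [q0 qm qmin]] := first_small m0.
have Nq : (N < q)%N.
  rewrite ltnNge; apply/negP => qN; have := mN q.-1.
  by rewrite prednK// => /(_ qN); rewrite ltNge (ltW qm).
have d0 := dist_int_gt0 q0.
have [z [E|E]] := dist_int_attained (q%:R * alpha); last first.
  exists q, z, (dist_int (q%:R * alpha)); split => //.
    by rewrite d0 (lt_trans qm).
  by move=> k /qmin; exact: lt_le_trans.
set d := dist_int (q%:R * alpha) in E d0 qm.
have [q' [q'0 q'd q'min]] := first_small d0.
have qq' : (q < q')%N.
  rewrite ltnNge leq_eqVlt; apply/negP => /predU1P[qE|lt].
    by move: q'd; rewrite qE ltxx.
  by have := qmin q'; rewrite q'0 lt => /(_ isT); lra.
have d'0 := dist_int_gt0 q'0.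
have [z' [E'|E']] := dist_int_attained (q'%:R * alpha); last first.
  exists q', z', (dist_int (q'%:R * alpha)); split => //.
  - exact: ltn_trans qq'.
  - by rewrite d'0; lra.
  - by move=> k /q'min; exact: lt_le_trans.
have := q'min (q' - q)%N; rewrite subn_gt0 qq' ltn_subrL q0 q'0 => /(_ isT) h.
have := dist_int_le ((q' - q)%:R * alpha) (z' - z).
move: q'd d'0 E' h; set d' := dist_int (q'%:R * alpha) => q'd d'0 E' h.
have -> : (q' - q)%:R * alpha - (z' - z)%:~R = d' - d.
  by rewrite natrB ?(ltnW qq')// mulrBl E E' intrB; ring.
by rewrite ler0_norm; lra.
Qed.

(** Steps of size [d < v - u] cannot jump over []u, v[]. Steps to the right start from the integer
    [floor u], steps to the left from [ceil v]. *)
Lemma orbit_dense (u v : R) : u < v ->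
  exists k z, (0 < k)%N /\ u < k%:R * alpha + z%:~R < v.
Proof.
move=> uv.
have [k k0 kuv] := @dist_int_small (v - u) ltac:(lra).
have d0 := dist_int_gt0 k0.
have [z] := dist_int_attained (k%:R * alpha).
move: kuv d0; set d := dist_int _ => kuv d0.
have dd : d * d^-1 = 1 by rewrite divff// gt_eqF.
have step (w : R) : 0 <= w -> exists m, (0 < m)%N /\ w < m%:R * d <= w + d.
  move=> w0; have w1 : 0 <= w * d^-1 by rewrite mulr_ge0// invr_ge0 ltW.
  have /andP[] := truncn_itv w1; set m := Num.trunc _ => m1 m2.
  exists m.+1; split => //.
  have -> : w = (w * d^-1) * d by rewrite -mulrA (mulrC _ d) dd mulr1.
  by rewrite -natr1 -[X in _ <= _ + X]mul1r -mulrDl ltr_pM2r// ler_pM2r// natr1 m2 -natr1 lerD2r.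
case=> E.
- set t := Num.floor u; have := floor_le u; rewrite -/t => tu.
  have [|m [m0 mm]] := step (u - t%:~R); first by lra.
  exists (m * k)%N, (t - m%:Z * z); split; first by rewrite muln_gt0 m0.
  rewrite natrM -mulrA E intrB intrM -pmulrn; move/andP: mm => [? ?].
  by apply/andP; split; nra.
- set t := Num.ceil v; have := ceil_ge v; rewrite -/t => tv.
  have [|m [m0 mm]] := step (t%:~R - v); first by lra.
  exists (m * k)%N, (t - m%:Z * z); split; first by rewrite muln_gt0 m0.
  rewrite natrM -mulrA E intrB intrM -pmulrn; move/andP: mm => [? ?].
  by apply/andP; split; nra.
Qed.

End diophantine.

(** * Monotone degree-one maps of the line *)

Section degree_one_maps.
Variable R : realType.
Implicit Types (H K F : R -> R) (x y : R).

Definition degree_one F := forall x, F (x + 1) = F x + 1.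

Lemma degree_one_int F x (z : int) : degree_one F -> F (x + z%:~R) = F x + z%:~R.
Proof.
move=> F1; have Fn (n : nat) w : F (w + n%:R) = F w + n%:R.
  elim: n => [|n IH]; first by rewrite !addr0.
  by rewrite -natr1 !addrA F1 IH.
case: z => n; first by rewrite -!pmulrn Fn.
rewrite NegzE intrN -pmulrn; apply: (addIr n.+1%:R).
by rewrite -Fn !subrK.
Qed.

Lemma continuous_ivt F a b v : continuous F -> a <= b -> F a <= v <= F b ->
  exists2 c, a <= c <= b & F c = v.
Proof.
move=> Fc ab /andP[av vb].
have [||c cab Fcv] := @IVT R F a b v ab.
- by apply: continuous_subspaceT.
- by rewrite ge_min av le_max vb orbT.
- by exists c => //; move: cab; rewrite in_itv.
Qed.

Lemma degree_one_surjective F v : continuous F -> degree_one F ->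
  exists x, F x = v.
Proof.
move=> Fc F1; pose m := Num.floor (v - F 0).
have := floor_itv (v - F 0); rewrite -/m => /andP[m1 m2].
have [||c _ <-] := @continuous_ivt F (m%:~R) ((m + 1)%:~R) v Fc; last by exists c.
  by rewrite ler_int lerDl.
have E z : F (z%:~R) = F 0 + z%:~R by rewrite -(degree_one_int 0 z F1) add0r.
by rewrite !E; apply/andP; split; lra.
Qed.

Lemma monotone_reflect_lt F x y : {homo F : x y / x <= y} -> F x < F y -> x < y.
Proof. by move=> Fm; rewrite !ltNge; apply: contra => /Fm. Qed.

(* Let D = K - H.  Take p = i0 alpha + k0 strictly between two values of D and a
   later left record q, at distance d; the points i alpha + k with i <= q closest
   to p are then at distance more than some s > d.  Along a sequence on which H
   increases by s, D passes from above p to below p; at that step [a, b],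
   K [a, b] - H b lies in [p - s, p[. *)
Lemma exists_gap_crossing (alpha : R) H K :
  (forall (k : nat) (z : int), (0 < k)%N -> k%:R * alpha <> z%:~R) ->
  continuous H -> {homo H : x y / x <= y} -> degree_one H ->
  {homo K : x y / x <= y} -> degree_one K ->
  (exists x y, K y - H y < K x - H x) ->
  exists a b (q : nat) (m : int),
    [/\ a < b < a + 1, (0 < q)%N, H a < H b + q%:R * alpha - m%:~R < H b &
      forall (i : nat) (z : int) c, (i <= q)%N -> a <= c <= b ->
        K c <> H b + i%:R * alpha + z%:~R].
Proof.
move=> irr Hc Hm H1 Km K1 [x [y0 Dxy0]].
(* [K - H] is 1-periodic, so [y0] can be moved to the right of [x] by an integer. *)
have [y xy Dxy] : exists2 y, x <= y & K y - H y < K x - H x.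
  exists (y0 + (Num.floor (x - y0) + 1)%:~R).
    by have := floor_itv (x - y0); rewrite !intrD => /andP[_ ?]; lra.
  by rewrite (degree_one_int _ _ K1) (degree_one_int _ _ H1); lra.
have Hxy : H x < H y by have := Km _ _ xy; lra.
have [i0 [k0 [i00 /andP[yp px]]]] := orbit_dense irr Dxy.
set p := i0%:R * alpha + k0%:~R in yp px.
(* The first bound on [s] forces the descent below [p]; [s < 1] gives [b < a + 1] and settles the
   index [i0] below. *)
have e0 : 0 < Num.min (p - (K y - H y)) 1 by rewrite lt_min ltr01 andbT subr_gt0.
have [q [m [d [i0q qE /andP[d0 de] dmin]]]] := left_record irr i0 e0.
have [|s [ds se smin]] :=
    @finite_gap _ (fun k => dist_int (k.+1%:R * alpha)) q.-1 _ _ de.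
  by move=> k kq; apply: dmin; rewrite -ltn_predRL.
have {}smin k : (0 < k < q)%N -> s < dist_int (k%:R * alpha).
  by case: k => // k kq; apply: smin; rewrite ltn_predRL.
move: se; rewrite lt_min => /andP[sp s1].
have s0 : 0 < s by lra.
(* [H] may be constant on intervals, so [f 0 = x] is imposed separately: there [K - H] exceeds
   [p]. *)
have /choice[f fE] (j : nat) : exists w, H w = H x + j%:R * s /\ (j = 0%N -> w = x).
  case: j => [|j]; first by exists x; rewrite mul0r addr0.
  by have [w] := degree_one_surjective (H x + j.+1%:R * s) Hc H1; exists w.
have Hf j : H (f j) = H x + j%:R * s by have [] := fE j.
have [j pj jp] : exists2 j, p <= K (f j) - H (f j) & K (f j.+1) - H (f j.+1) < p.
  apply: contrapT => nex.
  have allp j : p <= K (f j) - H (f j).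
    elim: j => [|j IH]; first by rewrite (fE 0%N).2//; exact: ltW.
    by rewrite leNgt; apply/negP => jp; apply: nex; exists j.
  have exj : exists j : nat, H y - H x <= j%:R * s.
    exists (Num.bound ((H y - H x) / s)).
    rewrite -ler_pdivrMr//; apply/ltW/archi_boundP.
    by rewrite divr_ge0 ?ltW// subr_gt0.
  (* At the last [j] with [H (f j) < H y], monotonicity of [K] bounds [K - H] by [K y - H y + s],
     which is less than [p]. *)
  case: (ex_minnP exj) => -[|j] jle jmin; first by rewrite mul0r in jle; lra.
  have jlt : j%:R * s < H y - H x.
    by rewrite ltNge; apply/negP => /jmin; rewrite ltnn.
  have fy : f j < y by apply: monotone_reflect_lt Hm _; rewrite Hf; lra.
  have := Km _ _ (ltW fy); have := allp j; move: jle.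
  rewrite Hf -natr1 mulrDl mul1r; lra.
have Hab : H (f j.+1) = H (f j) + s by rewrite !Hf -natr1; ring.
exists (f j), (f j.+1), q, m; split.
- apply/andP; split; apply: monotone_reflect_lt Hm _; first by lra.
  by rewrite H1; lra.
- exact: leq_ltn_trans i0q.
- by rewrite qE; apply/andP; split; lra.
- move=> i z c iq /andP[ac cb] Kc.
  have Kac := Km _ _ ac; have Kcb := Km _ _ cb.
  (* Equality would put [i alpha + z] in [[p - s, p[]. If [i <> i0], the index difference is between
     1 and [q - 1], thanks to [0 < i0 < q], so the distance exceeds [s]. If [i = i0], the difference
     is a positive integer, hence again more than [s]. *)
  have [ii0|i0i|ii0] := ltngtP i i0.
  + have := smin (i0 - i)%N; rewrite subn_gt0 ii0.
    rewrite (leq_ltn_trans (leq_subr i i0) i0q) => /(_ isT).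
    have := dist_int_le ((i0 - i)%:R * alpha) (z - k0).
    rewrite natrB ?(ltnW ii0)// intrB mulrBl ger0_norm; rewrite /p in pj jp; lra.
  + have := smin (i - i0)%N; rewrite subn_gt0 i0i.
    rewrite (leq_trans _ iq) ?ltn_subrL ?i00 ?(leq_trans _ i0i)// => /(_ isT).
    have := dist_int_le ((i - i0)%:R * alpha) (k0 - z).
    rewrite natrB ?(ltnW i0i)// intrB mulrBl ler0_norm; rewrite /p in pj jp; lra.
  + subst i; have zk : (z < k0)%R by rewrite -(ltr_int R); rewrite /p in pj jp; lra.
    move: zk; rewrite -lezD1 -(ler_int R) intrD; rewrite /p in pj jp; lra.
Qed.

(** A jump of a monotone function would leave an interval free of values. *)
Lemma monotone_dense_continuous H : {homo H : x y / x <= y} ->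
  (forall u v, u < v -> exists x, u < H x < v) -> continuous H.
Proof.
move=> Hm Hd x; apply/cvgrPdist_lt => e e0.
have [y /andP[y1 y2]] := Hd (H x - e) (H x) ltac:(lra).
have [z /andP[z1 z2]] := Hd (H x) (H x + e) ltac:(lra).
have yx := monotone_reflect_lt Hm y2; have xz := monotone_reflect_lt Hm z1.
near=> w; have yw : y < w by near: w; exact: lt_nbhsr.
have wz : w < z by near: w; exact: lt_nbhsl.
have := Hm _ _ (ltW yw); have := Hm _ _ (ltW wz).
by rewrite ltr_norml => *; apply/andP; split; lra.
Unshelve. all: by end_near.
Qed.

End degree_one_maps.

(** * Arcs of the circle, their topology and measurability *)

Section arcs.
Variable R : realType.
Implicit Types (x y w : R) (z : int) (f : circle R -> circle R) (F G : R -> R).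

Lemma circle_projD x z : circle_proj (x + z%:~R) = circle_proj x.
Proof. by apply/circle_projE; rewrite addrAC subrr add0r; apply/intrP; exists z. Qed.

Lemma circle_proj_eq x y : circle_proj x = circle_proj y ->
  exists z, x = y + z%:~R.
Proof. by move=> /circle_projE/intrP[z xyz]; exists z; rewrite -xyz addrC subrK. Qed.

Lemma circle_proj_surj (c : circle R) : exists x, circle_proj x = c.
Proof. by exists (repr c); rewrite /circle_proj reprK. Qed.

Lemma circle_proj_continuous : continuous (@circle_proj R).
Proof. exact: pi_continuous. Qed.

Lemma open_circle_proj_itv x y : open (@circle_proj R @` `]x, y[).
Proof.
(* Openness in the quotient topology is openness of the preimage, here a union of integer translates
   of the interval. *)
suff : open (@circle_proj R @^-1` (@circle_proj R @` `]x, y[)) by [].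
rewrite openE => w [u]; rewrite /= in_itv/= => /andP[xu uy] /circle_proj_eq[z uwz].
have xw : \forall v \near w, x - z%:~R < v by apply: lt_nbhsr; lra.
have wy : \forall v \near w, v < y - z%:~R by apply: lt_nbhsl; lra.
apply: filterS (filterI xw wy) => v [xv vy].
exists (v + z%:~R); last exact: circle_projD.
by rewrite /= in_itv/=; apply/andP; split; lra.
Qed.

(** Half-open arcs concatenate without overlap, so masses add up even if the measure has atoms. *)
Definition half_open_arc x y : set (borel_circle R) := @circle_proj R @` `[x, y[.

Lemma half_open_arc1 x : half_open_arc x (x + 1) = setT.
Proof.
apply/seteqP; split=> // c _; have [u <-] := circle_proj_surj c.
exists (u - (Num.floor (u - x))%:~R); last by rewrite -intrN circle_projD.
have := floor_itv (u - x); rewrite intrD => /andP[? ?].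
by rewrite /= in_itv/=; apply/andP; split; lra.
Qed.

Lemma half_open_arcD1 x y : half_open_arc (x + 1) (y + 1) = half_open_arc x y.
Proof.
apply/seteqP; split=> _ [u + <-]; rewrite /= in_itv/= => /andP[? ?].
- exists (u - 1); first by rewrite /= in_itv/=; apply/andP; split; lra.
  by rewrite -(circle_projD _ 1) subrK.
- exists (u + 1); first by rewrite /= in_itv/=; apply/andP; split; lra.
  exact: (circle_projD _ 1).
Qed.

Lemma half_open_arc_split x y w : x <= y <= w ->
  half_open_arc x w = half_open_arc x y `|` half_open_arc y w.
Proof.
move=> /andP[xy yw]; rewrite /half_open_arc -image_setU; congr (_ @` _).
apply/seteqP; split => u; rewrite /= !in_itv/=.
  by move=> /andP[xu uw]; have [uy|yu] := ltP u y; [left|right]; apply/andP.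
by move=> [|] /andP[? ?]; apply/andP; split; lra.
Qed.

(** Points of the two pieces with the same projection would differ by an integer strictly between 0
    and 1. *)
Lemma half_open_arc_disj x y w : x <= y <= w -> w <= x + 1 ->
  half_open_arc x y `&` half_open_arc y w = set0.
Proof.
move=> /andP[xy yw] wx; rewrite -subset0 => c [[u + <-] [v +]].
rewrite /= !in_itv/= => /andP[xu uy] /andP[yv vw] /circle_proj_eq[z vuz].
have z0 : 0 < z%:~R :> R by lra.
have z1 : z%:~R < 1%:~R :> R by lra.
by move: z0 z1; rewrite ltr0z ltr_int; case: z {vuz} => [[|[|?]]|?].
Qed.

Lemma measurable_open_circle (U : set (circle R)) : open U ->
  measurable (U : set (borel_circle R)).
Proof. by move=> oU; exact: sub_sigma_algebra. Qed.

(** A nonempty arc is its left endpoint, the complement of the open arc of length 1, together with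
    an open arc. *)
Lemma measurable_half_open_arc x y : y <= x + 1 -> measurable (half_open_arc x y).
Proof.
move=> yx; have [xy|yx'] := ltP x y; last first.
  rewrite /half_open_arc set_itv_ge ?image_set0; first exact: measurable0.
  by rewrite -leNgt bnd_simp.
have -> : half_open_arc x y =
    ~` (@circle_proj R @` `]x, x + 1[) `|` @circle_proj R @` `]x, y[.
  apply/seteqP; split => [_ [u + <-]|c].
    rewrite /= in_itv/= => /andP[]; rewrite le_eqVlt => /predU1P[<- _|xu uy].
      left => -[v]; rewrite /= in_itv/= => /andP[xv vx] /circle_proj_eq[z vxz].
      have z0 : 0 < z%:~R :> R by lra.
      have z1 : z%:~R < 1%:~R :> R by lra.
      by move: z0 z1; rewrite ltr0z ltr_int; case: z {vxz} => [[|[|?]]|?].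
    by right; exists u => //; rewrite /= in_itv/= xu.
  have : half_open_arc x (x + 1) c by rewrite half_open_arc1.
  move=> [u + <-]; rewrite /= in_itv/= => /andP[+ ux].
  rewrite le_eqVlt => /predU1P[<- _|xu [|[v + vu]]].
  - by exists x => //; rewrite /= in_itv/= lexx.
  - by move=> /(_ _)/=; case; exists u => //; rewrite /= in_itv/= xu.
  - rewrite /= in_itv/= => /andP[xv vy]; exists v => //.
    by rewrite /= in_itv/= vy (ltW xv).
have mo a b := measurable_open_circle (@open_circle_proj_itv a b).
by apply: measurableU; [exact: measurableC|].
Qed.

End arcs.

(** * Lifts of circle maps to the line *)

Section lifts.
Variable R : realType.
Implicit Types (x y w : R) (f : circle R -> circle R) (F G : R -> R).

Lemma iter_lift f F n x : is_lift f F ->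
  circle_proj (iter n F x) = iter n f (circle_proj x).
Proof. by move=> [_ fF]; elim: n => //= n <-. Qed.

(** The difference is continuous and integer-valued. With two distinct values it would also take the
    smaller one plus 1/2. *)
Lemma lift_unique f F G : is_lift f F -> is_lift f G ->
  exists z : int, forall x, F x = G x + z%:~R.
Proof.
move=> [Fc fF] [Gc fG].
have FG x : exists z : int, F x - G x = z%:~R.
  have [|z ->] := @circle_proj_eq R (F x) (G x); first by rewrite fF fG.
  by exists z; rewrite addrAC subrr add0r.
have [z0 E0] := FG 0; exists z0 => x; have [z E] := FG x.
suff : z = z0 by move=> zz; rewrite -zz -E addrC subrK.
apply: contrapT => /eqP.
pose g y := F y - G y.
have gc : continuous g by move=> y; apply: cvgB; [exact: Fc|exact: Gc].
have half v : g v != (Order.min z z0)%:~R + 1 / 2.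
  apply/eqP; rewrite /g; have [t ->] := FG v => tE.
  have t1 : (Order.min z z0)%:~R < t%:~R :> R by lra.
  have t2 : t%:~R < (Order.min z z0 + 1)%:~R :> R by rewrite intrD; lra.
  by move: t1 t2; rewrite !ltr_int ltzD1; case: leP; lia.
move=> zz.
have ivt a b : a <= b -> (g a = z%:~R /\ g b = z0%:~R) \/ (g a = z0%:~R /\ g b = z%:~R)
    -> False.
  move=> ab gab.
  have [||c _ /eqP] := @IVT R g a b ((Order.min z z0)%:~R + 1 / 2) ab.
  - exact: continuous_subspaceT.
  - have : ((Order.min z z0)%:~R + 1 / 2 : R) <= (Order.max z z0)%:~R.
      have : (Order.min z z0 + 1)%:~R <= (Order.max z z0)%:~R :> R.
        by rewrite ler_int; lia.
      by rewrite intrD; lra.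
    have [zlt|zlt|zlt] := ltgtP z z0; last by rewrite zlt eqxx in zz.
    + case: gab => -[-> ->] h; rewrite ge_min le_max.
      * by apply/andP; split; apply/orP; [left|right]; lra.
      * by apply/andP; split; apply/orP; [right|left]; lra.
    + case: gab => -[-> ->] h; rewrite ge_min le_max.
      * by apply/andP; split; apply/orP; [right|left]; lra.
      * by apply/andP; split; apply/orP; [left|right]; lra.
  - by apply/negP.
have [x0|x0] := leP 0 x; first by apply: (ivt 0 x) => //; right.
by apply: (ivt x 0); [exact: ltW|left].
Qed.

(** [F (x + 1) - F x] is a positive integer. If it were at least 2, [F] would take the value
    [F x + 1] strictly inside []x, x + 1[], against injectivity of [f]. *)
Lemma lift_degree_one f F : injective f -> is_lift f F ->
  {homo F : x y / x < y} -> degree_one F.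
Proof.
move=> finj [Fc fF] Fm x.
have [|z E] := @circle_proj_eq R (F (x + 1)) (F x).
  by rewrite !fF (circle_projD x 1).
have xx1 : x < x + 1 by rewrite ltrDl.
have z0 : (0 < z)%R by rewrite -(ltr0z R); have := Fm _ _ xx1; lra.
rewrite E; have [->//|z1] := eqVneq z 1.
have z2 : 1%:~R < z%:~R :> R by rewrite ltr_int; lia.
have [|c /andP[xc cx] cE] := @continuous_ivt R F x (x + 1) (F x + 1) Fc (ltW xx1).
  by rewrite E; apply/andP; split; lra.
have : circle_proj c = circle_proj x.
  by apply: finj; rewrite -!fF cE (circle_projD _ 1).
move=> /circle_proj_eq[t ct]; have tz : t%:~R = c - x :> R by lra.
have t0 : (0 <= t)%R by rewrite -(ler0z R); lra.
have t1 : (t <= 1)%R by rewrite -(ler_int R); lra.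
have [tE|tE] : t = 0 \/ t = 1 by lia.
- by move: cE; rewrite ct tE addr0; lra.
- by move: cE; rewrite ct tE E; lra.
Qed.

Lemma preimage_half_open_arc f F x y : is_lift f F -> degree_one F ->
  {homo F : x y / x < y} ->
  f @^-1` half_open_arc (F x) (F y) = half_open_arc x y.
Proof.
move=> [_ fF] F1 Fm; have Fle := le_mono Fm; have Flt := leW_mono Fle.
apply/seteqP; split => [c /=|_ [u + <-]].
  have [w <-] := circle_proj_surj c; rewrite -fF => -[v].
  rewrite /= in_itv/= => + /circle_proj_eq[z E].
  rewrite E -degree_one_int// Fle Flt => xwy.
  by exists (w + z%:~R); [rewrite /= in_itv|exact: circle_projD].
rewrite /= in_itv/= -fF => /andP[xu uy].
by exists (F u) => //; rewrite /= in_itv/= Fle Flt xu.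
Qed.

End lifts.

(** * The lifted distribution function of an invariant measure *)

Section cumulative_function.
Variable R : realType.
Variable mu : probability (borel_circle R) R.
Implicit Types (x y w : R) (f : circle R -> circle R) (F : R -> R).

Definition arc_mass x y : R := fine (mu (half_open_arc x y)).

Lemma arc_massE x y : y <= x + 1 -> (arc_mass x y)%:E = mu (half_open_arc x y).
Proof. by move=> yx; rewrite fineK// fin_num_measure//; exact: measurable_half_open_arc. Qed.

Lemma arc_mass_ge0 x y : 0 <= arc_mass x y.
Proof. exact/fine_ge0/measure_ge0. Qed.

Lemma arc_mass_split x y w : x <= y <= w -> w <= x + 1 ->
  arc_mass x w = arc_mass x y + arc_mass y w.
Proof.
move=> xyw wx; have /andP[xy yw] := xyw.
apply: EFin_inj; rewrite EFinD !arc_massE; [|lra..].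
rewrite (half_open_arc_split xyw) measureU//.
- by apply: measurable_half_open_arc; lra.
- by apply: measurable_half_open_arc; lra.
- exact: half_open_arc_disj.
Qed.

Lemma arc_massD1 x y : arc_mass (x + 1) (y + 1) = arc_mass x y.
Proof. by rewrite /arc_mass half_open_arcD1. Qed.

Lemma arc_mass1 x : arc_mass x (x + 1) = 1.
Proof. by rewrite /arc_mass half_open_arc1 probability_setT. Qed.

Lemma arc_mass_le1 x y : x <= y <= x + 1 -> arc_mass x y <= 1.
Proof.
move=> xy; rewrite -(arc_mass1 x) (@arc_mass_split x y (x + 1))//.
by rewrite lerDl arc_mass_ge0.
Qed.

(* A lift to R of the distribution function of mu. *)
Definition cumul x : R := (Num.floor x)%:~R + arc_mass (Num.floor x)%:~R x.

Lemma cumul_degree_one : degree_one cumul.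
Proof.
move=> x; rewrite /cumul floorDrz ?rpred1// floor1 intrD arc_massD1.
by rewrite addrAC.
Qed.

Lemma cumul_bounds x : (Num.floor x)%:~R <= cumul x <= (Num.floor x)%:~R + 1.
Proof.
rewrite /cumul lerDl arc_mass_ge0 lerD2l arc_mass_le1//.
by have := floor_itv x; rewrite intrD => /andP[-> /ltW].
Qed.

Lemma cumul_dist x : `|cumul x - x| <= 1.
Proof.
have := floor_itv x; rewrite intrD => /andP[? ?].
by have /andP[? ?] := cumul_bounds x; rewrite ler_norml; apply/andP; split; lra.
Qed.

Lemma cumul_monotone : {homo cumul : x y / x <= y}.
Proof.
move=> x y xy; have := le_floor xy; rewrite le_eqVlt => /predU1P[E|lt].
  rewrite /cumul -E (@arc_mass_split _ x y).
  - by rewrite addrA lerDl arc_mass_ge0.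
  - by rewrite xy andbT floor_le.
  - by have := floor_itv y; rewrite -E intrD => /andP[_ /ltW].
have /andP[_ h1] := cumul_bounds x; have /andP[h2 _] := cumul_bounds y.
apply: le_trans h1 _; apply: le_trans h2.
by rewrite -[1]/(1%:~R) -intrD ler_int lezD1.
Qed.

(** If an integer separates [x] from [y], the unit mass of the turn ending at that integer is split
    at [x]. *)
Lemma cumulB x y : x <= y <= x + 1 -> cumul y - cumul x = arc_mass x y.
Proof.
move=> /andP[xy yx].
have /andP[fx1 fx2] : (Num.floor x)%:~R <= x < (Num.floor x)%:~R + 1.
  by have := floor_itv x; rewrite intrD.
have [yf|fy] := ltP y ((Num.floor x)%:~R + 1).
  have E : Num.floor y = Num.floor x.
    by apply: floor_def; rewrite intrD yf andbT; lra.
  rewrite /cumul E (@arc_mass_split _ x y); [ring|by rewrite fx1|lra].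
have [E|E] := ltP y ((Num.floor x)%:~R + 1 + 1).
  have E' : Num.floor y = Num.floor x + 1.
    by apply: floor_def; rewrite !intrD E fy.
  rewrite /cumul E' intrD mulr1z (@arc_mass_split x ((Num.floor x)%:~R + 1) y)//; last first.
    by rewrite fy ltW.
  have := arc_mass1 (Num.floor x)%:~R.
  by rewrite (@arc_mass_split _ x (_ + 1)) ?fx1 ?(ltW fx2)//; lra.
by lra.
Qed.

Lemma arc_mass_lift f F x y : preserves_measure mu f -> is_lift f F ->
  degree_one F -> {homo F : x y / x < y} -> x <= y <= x + 1 ->
  arc_mass (F x) (F y) = arc_mass x y.
Proof.
move=> muf fF F1 Fm /andP[xy yx]; have Fle := le_mono Fm.
rewrite /arc_mass -[X in fine X]muf ?(preimage_half_open_arc _ _ fF)//.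
by apply: measurable_half_open_arc; rewrite -F1 Fle.
Qed.

(** Invariance equates the increments of [cumul mu \o F] and [cumul mu] on [[0, 1]]; degree one
    extends this to the line. *)
Lemma cumul_lift f F : preserves_measure mu f -> is_lift f F ->
  degree_one F -> {homo F : x y / x < y} ->
  exists alpha, forall x, cumul (F x) = cumul x + alpha.
Proof.
move=> muf fF F1 Fm; exists (cumul (F 0) - cumul 0) => x.
have H1 := cumul_degree_one.
set y := x - (Num.floor x)%:~R.
have -> : x = y + (Num.floor x)%:~R by rewrite subrK.
rewrite !(degree_one_int _ _ F1) !(degree_one_int _ _ H1).
have y01 : 0 <= y <= 0 + 1.
  by have := floor_itv x; rewrite intrD /y => /andP[? ?]; apply/andP; split; lra.
have Fle := le_mono Fm; have /andP[y0 y1] := y01.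
have := cumulB y01; rewrite -(arc_mass_lift muf fF F1 Fm y01) -cumulB; first lra.
by rewrite -F1 !Fle.
Qed.

(** [cumul mu] stays within 1 of the identity, so [iter n F x - x] stays within 2 of [n alpha]. *)
Lemma rotation_number_cumul F (alpha r x : R) :
  (forall x, cumul (F x) = cumul x + alpha) ->
  (iter n F x - x) / n%:R @[n --> \oo] --> r -> alpha = r.
Proof.
move=> HF cvr.
have HFn n : cumul (iter n F x) = cumul x + n%:R * alpha.
  by elim: n => [|n IH]; [rewrite mul0r addr0|rewrite /= HF IH -natr1; ring].
apply: contrapT => /eqP; rewrite -subr_eq0 -normr_gt0 => e0.
move/cvgrPdist_lt : cvr => /(_ (`|alpha - r| / 2) ltac:(lra))[N _ HN].
(* For this [n] the quotient [t] is more than [|alpha - r| / 2] away from [alpha], so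
   [n |alpha - t|] exceeds 2. *)
pose n := maxn N.+1 (Num.bound (4 / `|alpha - r|)).
have := HN n; rewrite /= leq_max leqnSn => /(_ isT).
have n0 : 0 < n%:R :> R by rewrite ltr0n leq_max.
have nb : 4 / `|alpha - r| < n%:R.
  apply: (@lt_le_trans _ _ (Num.bound (4 / `|alpha - r|))%:R).
    by apply: archi_boundP; rewrite divr_ge0// ltW.
  by rewrite ler_nat leq_maxr.
rewrite ltr_pdivrMr// in nb.
set t := (_ / _) => rt.
have tn : t * n%:R = iter n F x - x by rewrite /t divfK// gt_eqF.
have := cumul_dist (iter n F x); have := cumul_dist x; rewrite HFn !ler_norml.
move=> /andP[? ?] /andP[? ?].
have /andP[? ?] : - 2 <= (alpha - t) * n%:R <= 2.
  by rewrite mulrBl tn; apply/andP; split; lra.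
move: rt e0 nb; rewrite ltr_norml.
have [ar|ar] := leP 0 (alpha - r); [rewrite ger0_norm//|rewrite ltr0_norm//] => /andP[? ?] *.
- have : (alpha - r) / 2 < alpha - t by lra.
  by rewrite -(ltr_pM2r n0); lra.
- have : (r - alpha) / 2 < t - alpha by lra.
  by rewrite -(ltr_pM2r n0); lra.
Qed.

End cumulative_function.

(** * Recovering invariance of a measure from its distribution function *)

Section circle_section.
Variable R : realType.
Implicit Types (f : circle R -> circle R) (F : R -> R).

(** This section of the projection transports measures to the line, where agreement on rays suffices
    for equality. *)
Definition circle_repr01 (c : borel_circle R) : measurableTypeR R :=
  (repr (c : circle R) : R) - (Num.floor (repr (c : circle R) : R))%:~R.

Lemma circle_repr01K (c : circle R) : circle_proj (circle_repr01 c) = c.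
Proof. by rewrite /circle_repr01 -intrN circle_projD /circle_proj reprK. Qed.

Lemma circle_repr01_itv (c : circle R) : 0 <= (circle_repr01 c : R) < 1.
Proof.
have := floor_itv (repr c : R); rewrite intrD /circle_repr01 => /andP[? ?].
by apply/andP; split; lra.
Qed.

Lemma preimage_circle_repr01 (x : R) :
  circle_repr01 @^-1` `[x, +oo[ = half_open_arc (Num.max 0 x) 1.
Proof.
apply/seteqP; split => [c|_ [u + <-]].
  rewrite /= in_itv/= andbT => xc; exists (circle_repr01 c); last exact: circle_repr01K.
  by have /andP[c0 c1] := circle_repr01_itv c; rewrite /= in_itv/= ge_max c0 xc.
rewrite /= !in_itv/= andbT ge_max => /andP[/andP[u0 xu] u1].
have [z E] := circle_proj_eq (circle_repr01K (circle_proj u)).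
have /andP[c0 c1] := circle_repr01_itv (circle_proj u).
rewrite E; suff -> : z = 0 by rewrite addr0.
have z0 : -1%:~R < z%:~R :> R by lra.
have z1 : z%:~R < 1%:~R :> R by lra.
by move: z0 z1; rewrite -intrN !ltr_int; lia.
Qed.

Lemma measurable_circle_proj :
  measurable_fun [set: measurableTypeR R] (@circle_proj R : _ -> borel_circle R).
Proof.
have mE : @measurable _ (borel_circle R) = <<s @open (circle R) >> by [].
apply: (measurability _ mE) => _ [U oU <-].
rewrite setTI; apply: measurable_realfun.open_measurable.
by have /continuousP := @circle_proj_continuous R; exact.
Qed.

Variable mu : probability (borel_circle R) R.

(** Converse of [cumul_lift]: the images of [mu] under [circle_repr01 \o f] and [circle_repr01]
    agree on rays, whose preimages under [circle_repr01] are arcs ending at 1. Hence they agree on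
    all Borel sets. *)
Lemma preserves_measure_cumul f F (c : R) :
  is_lift f F -> degree_one F -> {homo F : x y / x < y} ->
  (forall x, cumul mu (F x) = cumul mu x + c) -> preserves_measure mu f.
Proof.
move=> fF F1 Fm Fc; have Fle := le_mono Fm; have Flt := leW_mono Fle.
have arcf (u : R) : 0 <= u -> measurable (f @^-1` half_open_arc u 1 : set (borel_circle R)) /\
    mu (f @^-1` half_open_arc u 1) = mu (half_open_arc u 1).
  move=> u0; have [u1|u1] := ltP u 1; last first.
    rewrite /half_open_arc set_itv_ge ?image_set0 ?preimage_set0.
      by split => //; exact: measurable0.
    by rewrite -leNgt bnd_simp.
  have [a aE] := degree_one_surjective u fF.1 F1.
  have [b bE] := degree_one_surjective 1 fF.1 F1.
  have ab : a <= b <= a + 1.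
    by rewrite -Fle -[b <= _]Fle F1 aE bE; apply/andP; split; lra.
  have /andP[_ ba] := ab.
  rewrite -aE -bE (preimage_half_open_arc _ _ fF)//; split.
    exact: measurable_half_open_arc.
  rewrite -!arc_massE//; last by rewrite aE bE; lra.
  congr EFin; rewrite -!cumulB// ?Fc; first lra.
  by rewrite aE bE; apply/andP; split; lra.
have gE : @measurable _ (measurableTypeR R) = <<s @measurable_realfun.RGenCInfty.G R >>.
  exact: measurable_realfun.RGenCInfty.measurableE.
have rE := preimage_circle_repr01.
have mr : measurable_fun [set: borel_circle R] circle_repr01.
  apply: (measurability _ gE) => _ [_ [x ->] <-].
  rewrite setTI rE; apply: measurable_half_open_arc.
  by rewrite lerDr le_max lexx.
have mrf : measurable_fun [set: borel_circle R] (circle_repr01 \o f).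
  apply: (measurability _ gE) => _ [_ [x ->] <-].
  by rewrite setTI comp_preimage rE; have [] := arcf (Num.max 0 x); rewrite ?le_max ?lexx.
pose X : {mfun borel_circle R >-> measurableTypeR R} := mfun_Sub (mem_set mr).
pose Y : {mfun borel_circle R >-> measurableTypeR R} := mfun_Sub (mem_set mrf).
have XY (B : set (measurableTypeR R)) : measurable B ->
    distribution mu Y B = distribution mu X B.
  (* These rays exhaust the line and have finite mass, as uniqueness of measures requires. *)
  pose g n : set (measurableTypeR R) := `[(- n%:R : R), +oo[%classic.
  apply: (measure_unique _ g gE _ _ _
    (distribution mu Y) (distribution mu X)).
  - move=> _ _ [x ->] [y ->]; exists (Num.max x y).
    by apply/seteqP; split => v; rewrite /= !in_itv/= !andbT ge_max => /andP.
  - by move=> n; exists (- n%:R).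
  - apply/seteqP; split => // v _; exists (Num.bound v) => //.
    by rewrite /g /= in_itv/= andbT lerNl ltW// unstable.ltrNbound.
  - move=> _ [x ->].
    change (mu (f @^-1` (circle_repr01 @^-1` `[x, +oo[)) =
            mu (circle_repr01 @^-1` `[x, +oo[)).
    by rewrite rE (arcf _ _).2// le_max lexx.
  - move=> n; rewrite -ge0_fin_numE//; apply: fin_num_measure.
    exact: measurable_itv.
move=> A mA.
(* Every Borel set [A] of the circle is the preimage under the section of its own lift to the
   line. *)
have mB := measurable_circle_proj measurableT mA; rewrite setTI in mB.
have : mu (f @^-1` (circle_repr01 @^-1` (@circle_proj R @^-1` A))) =
  mu (circle_repr01 @^-1` (@circle_proj R @^-1` A)) by exact: XY.
have -> : circle_repr01 @^-1` (@circle_proj R @^-1` A) = A.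
  by apply/seteqP; split => p /=; rewrite circle_repr01K.
by [].
Qed.

End circle_section.

Theorem theorem4p15 (R : realType) (phi psi : circle R -> circle R)
    (hphi : orientation_preserving_homeo phi)
    (hpsi : orientation_preserving_homeo psi)
    (rho : circle R) (hrho : is_rotation_number psi rho)
    (rho_irrational : irrational_mod1 rho)
    (mu : probability (borel_circle R) R)
    (mu_invariant : preserves_measure mu psi)
    (phi_not_invariant : ~ preserves_measure mu phi) :
  exists I : set (circle R), winning_interval (fun _ : 'I_1 => phi) psi I.
Proof.
case: hphi => -[phi' [_ _ phiK _]] [Phi Phil Phim].
case: hpsi => -[psi' [_ _ psiK _]] [Psi Psil Psim].
case: hrho => F [r [Fl Fcv rhoE]].
(* The lift [F] defining the rotation number is not assumed increasing; it inherits this from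
   [Psi]. *)
have [z0 FPsi] := lift_unique Fl Psil.
have Fm : {homo F : x y / x < y} by move=> x y /Psim; rewrite !FPsi ltrD2r.
have F1 := lift_degree_one (can_inj psiK) Fl Fm.
have Phi1 := lift_degree_one (can_inj phiK) Phil Phim.
have [alpha HF] := cumul_lift mu_invariant Fl F1 Fm.
have H1 := cumul_degree_one mu; have Hm := cumul_monotone mu.
have irr (k : nat) (z : int) : (0 < k)%N -> k%:R * alpha <> z%:~R.
  move=> k0 kz; apply: rho_irrational.
  exists r; last by rewrite rhoE.
  exists (z%:~R / k%:R) => //.
  rewrite -(rotation_number_cumul HF (Fcv 0)) fmorph_div/= ratr_int ratr_nat -kz.
  by rewrite mulrAC divff ?mul1r// pnatr_eq0 -lt0n.
have HFn n x : cumul mu (iter n F x) = cumul mu x + n%:R * alpha.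
  by elim: n => [|n IH]; [rewrite mul0r addr0|rewrite /= HF IH -natr1; ring].
(* On integer translates of the orbit of 0, [cumul mu] takes the values [cumul mu 0 + k alpha + z],
   which are dense. *)
have Hc : continuous (cumul mu).
  apply: monotone_dense_continuous => // u v uv.
  have [|k [z [_ kz]]] := @orbit_dense _ _ irr (u - cumul mu 0) (v - cumul mu 0).
    by rewrite ltrD2r.
  exists (iter k F 0 + z%:~R); rewrite (degree_one_int _ _ H1) HFn.
  by move/andP: kz => [? ?]; apply/andP; split; lra.
have Phile := le_mono Phim.
have K1 : degree_one (cumul mu \o Phi) by move=> x /=; rewrite Phi1 H1.
have Km : {homo cumul mu \o Phi : x y / x <= y} by move=> x y xy; apply: Hm; rewrite Phile.
have nonconst : exists x y, (cumul mu \o Phi) y - cumul mu y <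
                            (cumul mu \o Phi) x - cumul mu x.
  apply: contrapT => nex; apply: phi_not_invariant.
  apply: (@preserves_measure_cumul _ _ _ Phi (cumul mu (Phi 0) - cumul mu 0)) => // x.
  have le u v : cumul mu (Phi u) - cumul mu u <= cumul mu (Phi v) - cumul mu v.
    by rewrite leNgt; apply/negP => lt; apply: nex; exists u, v.
  by have := le x 0; have := le 0 x; lra.
have [a [b [q [m [/andP[ab ba] q0 /andP[aq qb] avoid]]]]] :=
  exists_gap_crossing irr Hc Hm H1 Km K1 nonconst.
exists (circle_arc a b), a, b; split => //; exists q => //; split.
  move=> _ i iq [_ [c + <-]]; rewrite /= in_itv/= => cab.
  (* A hit means [Phi c = iter i F b + z]; applying [cumul mu] gives the equality excluded by
     [avoid]. *)
  rewrite -Phil.2 -(iter_lift _ _ Fl) => /circle_proj_eq[z E].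
  apply: (avoid i z c iq cab).
  by rewrite /= E (degree_one_int _ _ H1) HFn.
rewrite -(iter_lift _ _ Fl) -(circle_projD _ (- m)).
(* The translate by [- m] is the lift of the final point that falls in []a, b[], as its [cumul mu]
   value shows. *)
have HE : cumul mu (iter q F b + (- m)%:~R) = cumul mu b + q%:R * alpha - m%:~R.
  by rewrite (degree_one_int _ _ H1) HFn intrN.
have aw : a < iter q F b + (- m)%:~R by apply: monotone_reflect_lt Hm _; rewrite HE.
have wb : iter q F b + (- m)%:~R < b by apply: monotone_reflect_lt Hm _; rewrite HE.
have sub : @circle_proj R @` `]a, b[ `<=` circle_arc a b.
  move=> _ [u + <-]; rewrite /= in_itv/= => /andP[au ub].
  by exists u => //; rewrite /= in_itv/= !ltW.
apply: (filterS sub); apply: open_nbhs_nbhs; split.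
  exact: open_circle_proj_itv.
by exists (iter q F b + (- m)%:~R) => //; rewrite /= in_itv/= aw.
Qed.
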